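(* Let $\alpha>-1/2$, let $n$ be a positive integer, and let $-1=\tau_0<\tau_1<\dots<\tau_n$ be the Gegenbauer-Gauss-Radau (GGR) points with Christoffel numbers $\varpi_0,\dots,\varpi_n$. Then the barycentric weights $\xi_i=1/\prod_{j\neq i}(\tau_j-\tau_i)$, $i=0,\dots,n$, for the GGR points are given by $$\xi_0=-\sqrt{(2\alpha+1)\,\varpi_0},\qquad \xi_i=(-1)^{i-1}\sqrt{(1-\tau_i)\,\varpi_i},\quad i=1,2,\dots,n.$$
   Context: For $\alpha>-1/2$, $G_n^{(\alpha)}$ denotes the degree-$n$ Gegenbauer polynomial (orthogonal on $[-1,1]$ with respect to the weight $(1-\tau^2)^{\alpha-1/2}$), normalized by $G_n^{(\alpha)}(1)=1$. The GGR points are the $n+1$ zeros $-1=\tau_0<\tau_1<\dots<\tau_n$ of $\mathcal{G}_{n+1}^{(\alpha)}=G_n^{(\alpha)}+G_{n+1}^{(\alpha)}$. The Christoffel numbers of the GGR quadrature on $[-1,1]$ are $\varpi_0=(\alpha+\tfrac12)\vartheta_0$ and $\varpi_j=\vartheta_j$ for $j=1,\dots,n$, where $$\vartheta_j=2^{2\alpha-1}\frac{\Gamma^2(\alpha+\frac12)\,n!}{(n+\alpha+\frac12)\,\Gamma(n+2\alpha+1)}\,(1-\tau_j)\,\bigl(G_n^{(\alpha)}(\tau_j)\bigr)^{-2},\quad j=0,\dots,n.$$ The barycentric weights of the nodes are defined by $\xi_i=1/\prod_{j\neq i}(\tau_j-\tau_i)$, $i=0,\dots,n$, the product being over $j\in\{0,\dots,n\}\setminus\{i\}$.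 They are used in the barycentric formula $\mathcal{L}_{n,i}(\tau)=\frac{\xi_i}{\tau-\tau_i}\big/\sum_{j=0}^n\frac{\xi_j}{\tau-\tau_j}$ for the Lagrange basis polynomials.
   Formalization: As stated the formulas fail (ξ_0 is always positive, and magnitudes differ, e.g. α=0, n=1); the formal theorem asserts them up to one nonzero factor c common to all ξ_i, i=0,…,n, which the barycentric formula does not see. *)

(* Defs.v *)
From HB Require Import structures.
From mathcomp Require Import all_boot all_order all_algebra.
From mathcomp Require Import all_classical all_reals all_analysis.
Import Order.TTheory GRing.Theory Num.Theory.
Import numFieldNormedType.Exports.

Set Implicit Arguments.
Unset Strict Implicit.
Unset Printing Implicit Defensive.

Local Open Scope classical_set_scope.
Local Open Scope ring_scope.

(* Euler's integral; used only at positive arguments, where it converges. *)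
Definition Gamma (R : realType) (x : R) : R :=
  \int[@lebesgue_measure R]_(t in `]0, +oo[) (t `^ (x - 1) * expR (- t)).

(* The endpoints are excluded because [0 `^ a] is a conventional value for
   a < 0; they have measure zero. *)
Definition gegenbauer_dot (R : realType) (alpha : R) (p q : {poly R}) : R :=
  \int[@lebesgue_measure R]_(t in `]-1, 1[)
    (p.[t] * q.[t] * (1 - t ^+ 2) `^ (alpha - 2^-1)).

(* For alpha > -1/2 exactly one family G satisfies this. *)
Definition gegenbauer_family (R : realType) (alpha : R) (G : nat -> {poly R})
    : Prop :=
  [/\ forall k, size (G k) = k.+1,
      forall k, (G k).[1] = 1
    & forall k l, k != l -> gegenbauer_dot alpha (G k) (G l) = 0].

Definition ggr_points (R : realType) (G : nat -> {poly R}) (n : nat)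
    (tau : 'I_n.+1 -> R) : Prop :=
  [/\ tau ord0 = -1,
      forall i j : 'I_n.+1, (i < j)%N -> tau i < tau j
    & forall x, root (G n + G n.+1) x <-> exists i, x = tau i].

Definition ggr_theta (R : realType) (alpha : R) (G : nat -> {poly R}) (n : nat)
    (tau : 'I_n.+1 -> R) (j : 'I_n.+1) : R :=
  2 `^ (2 * alpha - 1)
  * (Gamma (alpha + 2^-1) ^+ 2 * n`!%:R
     / ((n%:R + alpha + 2^-1) * Gamma (n%:R + 2 * alpha + 1)))
  * (1 - tau j) * (G n).[tau j] ^- 2.

Definition ggr_christoffel (R : realType) (alpha : R) (G : nat -> {poly R})
    (n : nat) (tau : 'I_n.+1 -> R) (j : 'I_n.+1) : R :=
  if j == ord0 then (alpha + 2^-1) * ggr_theta alpha G tau j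
  else ggr_theta alpha G tau j.

(* Pitfall: the barycentric formula
     (w_i / (x - tau_i)) / \sum_j w_j / (x - tau_j)
   for the Lagrange basis is homogeneous of degree 0 in w, so closed forms of
   barycentric weights are customarily given up to a nonzero factor common to
   all nodes.  [bary_weight] itself is not rescaled; for increasing nodes it is
   positive at [ord0], unlike [- Num.sqrt _]. *)
Definition bary_weight (R : realType) (n : nat) (tau : 'I_n.+1 -> R)
    (i : 'I_n.+1) : R :=
  (\prod_(j < n.+1 | j != i) (tau j - tau i))^-1.

(* Main.v *)
Require Import Defs.
From HB Require Import structures.
From mathcomp Require Import all_boot all_order all_algebra.
From mathcomp Require Import all_classical all_reals all_analysis.
From mathcomp Require Import measurable_realfun ring lra.
Import Order.TTheory GRing.Theory Num.Theory.
Import numFieldNormedType.Exports.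

Set Implicit Arguments.
Unset Strict Implicit.
Unset Printing Implicit Defensive.

Local Open Scope classical_set_scope.
Local Open Scope ring_scope.

(** Write P = G_n + G_(n+1), a = alpha + 1/2 and N = 2 n + 2 a.  Up to the
    factor lead_coef P, the reciprocal of a barycentric weight is, in absolute
    value, the derivative of P at the node ([bary_weight_deriv]), and its sign
    is (-1)^i because exactly i nodes lie to the left of the i-th one
    ([bary_weight_sign]).  Everything therefore rests on the value of P' at
    the nodes, which is read off the polynomial identity
<<
      (1 - X^2) P' + (n + 1) X P + (n + 2 a - 1) P = N (1 + X) G_n
>>
    of [ggr_structure_relation].  At a node t <> -1 it gives
    (1 - t) P'(t) = N G_n(t); at t = -1 it degenerates, and its derivative
    gives 2 a P'(-1) = N G_n(-1).  Substituting these in the Christoffel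
    numbers turns every square root of the theorem into sqrt K * N / |P'(t)|,
    where K is the factor of theta_j that does not depend on j.  So all
    weights carry the common factor c = - |lead_coef P| / (sqrt K * N).

    The identity holds because the difference U of its two sides has degree at
    most n + 1 and is orthogonal to all polynomials of degree less than n.
    Hence U is a combination of G_n and G_(n+1) ([orthogonal_two_terms]), and
    vanishing at 1 and at -1 kills both coefficients, since G_n(-1) <> 0
    ([gegenbauer_N1_neq0]).  Orthogonality of U uses only one analytic fact
    about the functional q |-> \int q (1 - t^2)^(a - 1), its Pearson equation
    [weight_moment_Pearson], which says that the derivative of q (1 - t^2)^a
    has integral 0 because the primitive vanishes at both ends.  The
    hypotheses on the family G are turned into linear algebra by the
    positivity [weight_moment_gt0].

    The integrals are improper for general alpha.  They are handled by
    exhausting an open interval by segments: a nonnegative function dominated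
    by the derivative of a bounded function is integrable
    ([bounded_primitive_integrable]).  This applies to the weight and to
    Euler's integral; the latter is needed only to know that K > 0. *)

(** * Integrals over an open set exhausted by segments *)

Lemma segment_FTC (R : realType) (D : set R) (F f : R -> R) (a b : R) :
  (forall x, D x -> is_derive x 1 F (f x)) ->
  (forall x, D x -> {for x, continuous f}) ->
  `[a, b] `<=` D -> a < b ->
  (\int[@lebesgue_measure R]_(x in `[a, b]) (f x)%:E = (F b - F a)%:E)%E.
Proof.
move=> dF cf abD ab; rewrite EFinB; apply: continuous_FTC2 => //.
- apply: continuous_in_subspaceT => x; rewrite inE => /abD; exact: cf.
- have cF x : x \in `[a, b] -> F y @[y --> x] --> F x.
    move=> xab; apply: differentiable_continuous; apply/derivable1_diffP.
    by have [] := dF x (abD _ xab).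
  split.
  + by move=> x xab; have [] := dF x (abD _ (@subset_itv_oo_cc _ _ a b x xab)).
  + by apply/cvg_at_right_filter/cF; rewrite in_itv/= lexx ltW.
  + by apply/cvg_at_left_filter/cF; rewrite in_itv/= lexx ltW.
- move=> x xab; rewrite derive1E.
  by have [] := dF x (abD _ (@subset_itv_oo_cc _ _ a b x xab)).
Qed.

Definition exhausts (R : realType) (u v : nat -> R) (D : set R) : Prop :=
  [/\ forall k, u k < v k, nonincreasing_seq u,
      nondecreasing_seq v & D = \bigcup_k `[u k, v k]%classic].

(** Dominated by [g = F'], the integrals of [f] over the exhausting segments
    stay below [2 * M]; monotone convergence passes this bound to [D]. *)
Lemma bounded_primitive_integrable (R : realType) (u v : nat -> R)
    (D : set R) (F f g : R -> R) (M : R) :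
  exhausts u v D -> measurable D -> measurable_fun D f ->
  (forall x, D x -> is_derive x 1 F (g x)) ->
  (forall x, D x -> {for x, continuous g}) ->
  (forall x, D x -> 0 <= f x <= g x) -> (forall x, D x -> `|F x| <= M) ->
  (@lebesgue_measure R).-integrable D (EFin \o f).
Proof.
move=> [uv du iv DE] mD mf dF cg fg FM.
have IkD k : `[u k, v k] `<=` D by rewrite DE => x; exists k.
apply/integrableP; split; first exact/measurable_EFinP.
rewrite (_ : integral _ _ _ =
    \int[@lebesgue_measure R]_(x in D) (f x)%:E)%E; last first.
  apply: eq_integral => x; rewrite inE => /fg /andP[f0 _] /=.
  by rewrite ger0_norm.
apply: (@le_lt_trans _ _ (2 * M)%:E); last by rewrite ltry.
have cvI : (\int[@lebesgue_measure R]_(x in `[u k, v k]) (f x)%:E @[k --> \oo] -->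
   \int[@lebesgue_measure R]_(x in D) (f x)%:E)%E.
  rewrite [in X in _ --> X]DE; apply: ge0_nondecreasing_set_cvg_integral.
  - move=> k l kl; apply/subsetPset => x /=; rewrite !in_itv/= => /andP[? ?].
    by apply/andP; split;
      [apply: le_trans (du _ _ kl) _|apply: le_trans (iv _ _ kl)].
  - by [].
  - by move=> k; apply/measurable_EFinP; apply: measurable_funS mf.
  - by move=> k x /IkD /fg /andP[? _]; rewrite lee_fin.
rewrite -(cvg_lim _ cvI)//; apply: lime_le; first exact: cvgP cvI.
apply: nearW => k.
apply: (@le_trans _ _ (\int[@lebesgue_measure R]_(x in `[u k, v k]) (g x)%:E)%E).
  apply: ge0_le_integral => //.
  - by move=> x /IkD /fg /andP[? _]; rewrite lee_fin.
  - by apply/measurable_EFinP; apply: measurable_funS mf.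
  - apply/measurable_EFinP; apply: subspace_continuous_measurable_fun => //.
    apply: continuous_in_subspaceT => x; rewrite inE => /IkD; exact: cg.
  - by move=> x /IkD /fg /andP[_ ?]; rewrite lee_fin.
rewrite (segment_FTC dF cg (IkD k) (uv k)) lee_fin.
have := FM (u k) (IkD k _ _); rewrite /= in_itv/= lexx ltW// => /(_ isT).
have := FM (v k) (IkD k _ _); rewrite /= in_itv/= lexx ltW// => /(_ isT).
rewrite !ler_norml => /andP[? ?] /andP[? ?].
lra.
Qed.

(** The integrals over the segments are [F (v k) - F (u k)], and they converge
    to the integral over [D] by dominated convergence. *)
Lemma integral_vanishing_primitive (R : realType) (u v : nat -> R)
    (D : set R) (F f : R -> R) :
  exhausts u v D -> measurable D ->
  (forall x, D x -> is_derive x 1 F (f x)) ->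
  (forall x, D x -> {for x, continuous f}) ->
  (@lebesgue_measure R).-integrable D (EFin \o f) ->
  F (u k) @[k --> \oo] --> 0 -> F (v k) @[k --> \oo] --> 0 ->
  \int[@lebesgue_measure R]_(x in D) f x = 0.
Proof.
move=> [uv du iv DE] mD dF cf intf Fu Fv.
have IkD k : `[u k, v k] `<=` D by rewrite DE => x; exists k.
have mf := measurable_int _ intf.
pose f_ k := (EFin \o f) \_ `[u k, v k]%classic.
have [] := @dominated_convergence _ _ _ (@lebesgue_measure R) D mD f_
  (EFin \o f) (abse \o (EFin \o f)).
- move=> k; apply/(measurable_restrict _ _ _) => //.
  by apply: measurable_funS mf => // x [].
- by [].
- apply: aeW => x Dx; apply: cvg_near_cst.
  move: Dx; rewrite DE => -[m _ xm]; exists m => // k /= mk.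
  rewrite /f_ patchE mem_set//.
  move: xm => /=; rewrite !in_itv/= => /andP[? ?].
  by apply/andP; split; [apply: le_trans (du _ _ mk) _|apply: le_trans (iv _ _ mk)].
- exact: integrable_abse.
- apply: aeW => x k Dx; rewrite /f_ patchE; case: ifP => //= _.
  by rewrite normr0 lee_fin.
move=> _ _ h.
have : [sequence (\int[@lebesgue_measure R]_(x in D) f_ n x)%E]_n @ \oo --> (0 : R)%:E.
  rewrite (_ : [sequence _]_n = EFin \o (fun k => F (v k) - F (u k))); last first.
    apply/funext => k /=.
    rewrite -integral_mkcondr setIidr//.
    exact: segment_FTC.
  apply/cvg_EFin; first by apply: nearW.
  by rewrite -[X in _ --> X](subrr 0); apply: cvgB.
move/(cvg_unique _ h) => /(_ (@ereal_hausdorff R)) E.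
by rewrite /Rintegral E.
Qed.

(** A nonnegative integrable function with zero integral vanishes almost
    everywhere, so [D] would be covered by a null set and the countable [S]. *)
Lemma Rintegral_gt0 (R : realType) (D S : set R) (f : R -> R) :
  measurable D -> lebesgue_measure D != 0%E -> countable S ->
  (@lebesgue_measure R).-integrable D (EFin \o f) ->
  (forall x, D x -> 0 <= f x) -> (forall x, D x -> ~ S x -> f x != 0) ->
  0 < \int[@lebesgue_measure R]_(x in D) f x.
Proof.
move=> mD D0 cS intf f0 fS.
rewrite lt_neqAle Rintegral_ge0// andbT; apply/negP => /eqP If.
have I0 : (\int[@lebesgue_measure R]_(x in D) `|(EFin \o f) x| = 0)%E.
  rewrite (_ : integral _ _ _ =
    \int[@lebesgue_measure R]_(x in D) (f x)%:E)%E; last first.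
    by apply: eq_integral => x; rewrite inE => /f0 ? /=; rewrite ger0_norm.
  by rewrite -[LHS]fineK ?integrable_fin_num//; congr EFin; exact: esym If.
have := (@ae_eq_integral_abs _ _ _ (@lebesgue_measure R) D mD _
  (measurable_int _ intf)).1 I0.
move=> [N [mN N0 sN]]; move/eqP: D0; apply.
apply: (@subset_measure0 _ _ _ lebesgue_measure D (N `|` S)) => //.
- apply: measurableU => //; exact: countable_measurable cS.
- move=> x Dx; have [Sx|nSx] := pselect (S x); [by right|left].
  apply: sN => /= /(_ Dx) /= []; apply/eqP; exact: fS.
- apply: null_set_setU => //; first exact: countable_measurable cS.
  exact: countable_lebesgue_measure0.
Qed.

Lemma exhausts_pos (R : realType) :
  exhausts (fun k => k.+2%:R^-1 : R) (fun k => k.+1%:R) `]0, +oo[.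
Proof.
split.
- move=> k; apply: (@lt_le_trans _ _ 1); last by rewrite ler1n.
  by rewrite invf_lt1 ?ltr1n.
- by move=> k l kl; rewrite lef_pV2 ?posrE// ler_nat.
- by move=> k l kl; rewrite ler_nat.
- apply/seteqP; split => [x|x [k _]] /=; last first.
    rewrite !in_itv/= andbT => /andP[h _]; apply: lt_le_trans h.
    by rewrite invr_gt0.
  rewrite in_itv/= andbT => x0.
  have [m xm] : exists m : nat, x + x^-1 < m%:R.
    by eexists; exact: truncnS_gt.
  have xV0 : 0 < x^-1 by rewrite invr_gt0.
  exists m => //=; rewrite in_itv/=; apply/andP; split.
    rewrite -[leRHS]invrK lef_pV2 ?posrE//.
    rewrite -!natr1; lra.
  rewrite -!natr1; lra.
Qed.

Lemma exhausts_oo (R : realType) :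
  exhausts (fun k => k.+3%:R^-1 - 1 : R) (fun k => 1 - k.+3%:R^-1) `]-1, 1[.
Proof.
have h0 k : 0 < k.+3%:R^-1 :> R by rewrite invr_gt0.
split.
- move=> k; have h2 : k.+3%:R^-1 < 2^-1 :> R.
    by rewrite ltf_pV2 ?posrE// ltr_nat.
  by move: (_.+3%:R^-1) h2 => h ?; lra.
- by move=> k l kl; rewrite lerD2r lef_pV2 ?posrE// ler_nat.
- by move=> k l kl; rewrite lerD2l lerN2 lef_pV2 ?posrE// ler_nat.
- apply/seteqP; split => [x|x [k _]] /=; last first.
    by rewrite !in_itv/=; move: (_^-1) (h0 k) => h ? /andP[? ?]; lra.
  rewrite in_itv/= => /andP[x1 x2].
  have d0 : 0 < 1 - `|x| by rewrite subr_gt0 ltr_norml x1.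
  have [m xm] : exists m : nat, (1 - `|x|)^-1 < m%:R.
    by eexists; exact: truncnS_gt.
  have : m.+3%:R^-1 <= 1 - `|x|.
    rewrite -[leRHS]invrK lef_pV2 ?posrE ?invr_gt0//.
    by move: (_^-1) xm => y ?; rewrite -!natr1; lra.
  rewrite lerBrDl -lerBrDr => xh; exists m => //=.
  by rewrite in_itv/= -opprB -ler_norml.
Qed.

(** * Positivity of Euler's integral *)

(** From [u <= exp u] at [u = t / (2 * x)], raised to the power [x]: the
    exponential absorbs the power with half of the decay to spare. *)
Lemma powR_le_expR (R : realType) (x t : R) : 0 < x -> 0 < t ->
  t `^ x <= (2 * x) `^ x * expR (t / 2).
Proof.
move=> x0 t0.
have x20 : 0 <= 2 * x by rewrite mulr_ge0 ?ltW.
have h : t <= 2 * x * expR (t / (2 * x)).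
  rewrite -ler_pdivrMl ?mulr_gt0// mulrC.
  by apply: le_trans (expR_ge1Dx _); rewrite lerDr.
apply: (@le_trans _ _ ((2 * x * expR (t / (2 * x))) `^ x)).
  by rewrite ge0_ler_powR ?(ltW x0) ?nnegrE ?(ltW t0)// mulr_ge0 ?expR_ge0.
rewrite powRM ?expR_ge0//.
rewrite -expRM (_ : t / (2 * x) * x = t / 2)//.
by field; apply/eqP => ?; lra.
Qed.

(** Integration by parts at the level of primitives: with
    [B = t^x exp(-t)] one has [x * t^(x-1) exp(-t) = B' + t^x exp(-t)], and the
    last term is at most [C exp(-t/2)], whose primitive is bounded. *)
Lemma Gamma_integrable (R : realType) (x : R) : 0 < x ->
  (@lebesgue_measure R).-integrable `]0, +oo[
    (EFin \o (fun t => t `^ (x - 1) * expR (- t))).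
Proof.
move=> x0; pose C : R := (2 * x) `^ x.
have C0 : 0 <= C := powR_ge0 _ _.
have xn0 : x != 0 by rewrite gt_eqF.
pose h (t : R) : R := t `^ (x - 1) * expR (- t)
  + x^-1 * (C * expR (- (t / 2)) - t `^ x * expR (- t)).
have e2 (t : R) : expR (- t) = expR (- (t / 2)) * expR (- (t / 2)).
  by rewrite -expRD; congr expR; field.
have key (t : R) : 0 < t -> t `^ x * expR (- t) <= C * expR (- (t / 2)).
  move=> t0; rewrite e2 mulrA ler_wpM2r ?expR_ge0//.
  by rewrite expRN ler_pdivrMr ?expR_gt0// powR_le_expR.
apply: (@bounded_primitive_integrable R _ _ _
  (fun t => x^-1 * (t `^ x * expR (- t) - 2 * C * expR (- (t / 2)))) _ h
  (x^-1 * (2 * C)) (exhausts_pos R)) => //.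
- apply: measurable_funM.
    by apply: measurable_funS (@measurable_powR R (x - 1)).
  apply: measurable_funS (_ : measurable_fun setT _) => //.
  apply: continuous_measurable_fun => t; apply: continuous_comp.
    exact: opp_continuous.
  exact: continuous_expR.
- move=> t /=; rewrite in_itv/= andbT => t0.
  have ? := is_derive1_powR x t0.
  apply: is_derive_eq.
  rewrite /h /GRing.scale/=; field => //.
- move=> t /=; rewrite in_itv/= andbT => t0.
  have ? := is_derive1_powR x t0; have ? := is_derive1_powR (x - 1) t0.
  by apply: differentiable_continuous; apply/derivable1_diffP; apply: ex_derive.
- move=> t /=; rewrite in_itv/= andbT => t0.
  rewrite mulr_ge0 ?powR_ge0 ?expR_ge0//= lerDl mulr_ge0 ?invr_ge0 ?(ltW x0)//.
  by rewrite subr_ge0 key.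
- move=> t /=; rewrite in_itv/= andbT => t0.
  rewrite normrM gtr0_norm ?invr_gt0// ler_pM2l ?invr_gt0//.
  have ? := key _ t0.
  have ? : 0 <= t `^ x * expR (- t) by rewrite mulr_ge0 ?powR_ge0 ?expR_ge0.
  have ? : C * expR (- (t / 2)) <= C by rewrite ler_piMr// -[leRHS]expR0 ler_expR; lra.
  have ? : 0 <= C * expR (- (t / 2)) by rewrite mulr_ge0 ?expR_ge0.
  by rewrite ler_norml; apply/andP; split; lra.
Qed.

Lemma Gamma_gt0 (R : realType) (x : R) : 0 < x -> 0 < Gamma x.
Proof.
move=> x0; apply: (@Rintegral_gt0 _ _ set0) => //.
- by rewrite lebesgue_measure_itv/= ltry.
- exact: Gamma_integrable.
- by move=> t _; rewrite mulr_ge0 ?powR_ge0 ?expR_ge0.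
- move=> t /=; rewrite in_itv/= andbT => t0 _.
  by rewrite gt_eqF// mulr_gt0 ?powR_gt0 ?expR_gt0.
Qed.

(** * The Gegenbauer weight and its moments *)

Lemma onem_sqr_gt0 (R : realType) (t : R) : t \in `]-1, 1[ -> 0 < 1 - t ^+ 2.
Proof. by rewrite in_itv/= => /andP[? ?]; nra. Qed.

(** Both terms of the derivative share the factor (1 - t^2)^(a - 1), so it is
    a polynomial times the weight: this is what makes the weight classical. *)
Lemma is_derive_horner_weight (R : realType) (a : R) (q : {poly R}) (t : R) :
  0 < a -> t \in `]-1, 1[ ->
  is_derive t 1 (fun s => q.[s] * (1 - s ^+ 2) `^ a)
    ((q^`() * (1 - 'X^2) - (2 * a) *: ('X * q)).[t] * (1 - t ^+ 2) `^ (a - 1)).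
Proof.
move=> a0 /onem_sqr_gt0 t0.
have dw : is_derive t 1 (fun s : R => (1 - s ^+ 2) `^ a)
    (a * (1 - t ^+ 2) `^ (a - 1) * (- (2 * t))).
  have dp := is_derive1_powR a t0.
  apply: (@is_derive1_comp _ (@powR R ^~ a) (fun s => 1 - s ^+ 2)) dp _.
  apply: is_derive_eq; rewrite /GRing.scale/=; ring.
have ? := is_derive_poly q t.
apply: is_derive_eq.
rewrite /GRing.scale/= !hornerE.
rewrite -(mulr_powRB1 (ltW t0) a0)/=; ring.
Qed.

Lemma continuous_horner_weight (R : realType) (a : R) (q : {poly R}) (t : R) :
  t \in `]-1, 1[ -> {for t, continuous (fun s => q.[s] * (1 - s ^+ 2) `^ a)}.
Proof.
move=> /onem_sqr_gt0 t0.
apply: continuousM; first exact: continuous_horner.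
have dp := is_derive1_powR a t0.
apply: (@continuous_comp _ _ _ (fun s : R => 1 - s ^+ 2) (@powR R ^~ a)).
  by apply: differentiable_continuous; apply/derivable1_diffP.
by apply: differentiable_continuous; apply/derivable1_diffP; case: dp.
Qed.

Lemma measurable_horner_weight (R : realType) (a : R) (q : {poly R}) :
  measurable_fun (`]-1, 1[ : set R) (fun s => q.[s] * (1 - s ^+ 2) `^ a).
Proof.
apply: open_continuous_measurable_fun => // x; rewrite inE => xI.
exact: continuous_horner_weight.
Qed.

Lemma bounded_horner (R : realType) (q : {poly R}) :
  exists M : R, forall t : R, t \in `]-1, 1[ -> `|q.[t]| <= M.
Proof.
exists (\sum_(i < size q) `|q`_i|) => t; rewrite in_itv/= => t1.
rewrite horner_coef (le_trans (ler_norm_sum _ _ _))//.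
apply: ler_sum => i _; rewrite normrM ler_piMr//.
by rewrite normrX exprn_ile1// ltW// ltr_norml.
Qed.

Lemma onem_sqr_powR_le1 (R : realType) (a t : R) : 0 < a -> t \in `]-1, 1[ ->
  (1 - t ^+ 2) `^ a <= 1.
Proof.
have E : 1 `^ a = 1 :> R by rewrite powR1.
move=> a0 tI; rewrite -[leRHS]E ge0_ler_powR ?nnegrE ?(ltW a0)//.
  by rewrite (ltW (onem_sqr_gt0 tI)).
by rewrite gerBl sqr_ge0.
Qed.

(** The primitive is a multiple of (2 a + 1) t - t (1 - t^2)^a.  Indeed the
    derivative of t (1 - t^2)^a equals
    (2 a + 1) (1 - t^2)^a - 2 a (1 - t^2)^(a - 1), and (1 - t^2)^a <= 1. *)
Lemma weight_integrable (R : realType) (a : R) : 0 < a ->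
  (@lebesgue_measure R).-integrable `]-1, 1[
    (EFin \o (fun t => (1 - t ^+ 2) `^ (a - 1))).
Proof.
move=> a0.
have an0 : 2 * a != 0 by rewrite mulf_neq0// gt_eqF.
have a20 : 0 < (2 * a)^-1 by rewrite invr_gt0 mulr_gt0.
pose F (t : R) := (2 * a)^-1 * ((2 * a + 1) * t - 'X.[t] * (1 - t ^+ 2) `^ a).
pose g (t : R) := (2 * a)^-1 * ((2 * a + 1) - (deriv 'X * (1 - 'X^2)
  - (2 * a) *: ('X * 'X)).[t] * (1 - t ^+ 2) `^ (a - 1)).
apply: (@bounded_primitive_integrable R _ _ _ F _ g
  ((2 * a)^-1 * (2 * a + 2)) (exhausts_oo R)); first by [].
- rewrite (_ : (fun t : R => _) =
    fun t => (1 : {poly R}).[t] * (1 - t ^+ 2) `^ (a - 1)).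
    exact: measurable_horner_weight.
  by apply/funext => t; rewrite hornerE mul1r.
- move=> t tI.
  have ? := is_derive_horner_weight 'X a0 tI.
  apply: is_derive_eq.
  by rewrite /g /GRing.scale/=; ring.
- move=> t tI; apply: continuousM; first exact: cst_continuous.
  apply: continuousB; first exact: cst_continuous.
  exact: continuous_horner_weight.
- move=> t tI; rewrite powR_ge0/= /g.
  rewrite -[leLHS]mul1r -{1}(mulVf an0) -mulrA ler_pM2l//.
  rewrite derivX !hornerE/=.
  have := onem_sqr_powR_le1 a0 tI.
  rewrite -(mulr_powRB1 (ltW (onem_sqr_gt0 tI)) a0).
  move: (_ `^ _) => w h.
  rewrite -subr_ge0.
  rewrite (_ : _ - _ = (2 * a + 1) * (1 - (1 - t ^+ 2) * w)); last by ring.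
  by rewrite mulr_ge0 ?subr_ge0// addr_ge0// ltW// mulr_gt0.
- move=> t tI.
  rewrite normrM gtr0_norm// ler_pM2l//.
  have w1 := onem_sqr_powR_le1 a0 tI; have := powR_ge0 (1 - t ^+ 2) a.
  move: (_ `^ _) w1 => w w1 w0; rewrite hornerX.
  rewrite (_ : _ - _ = (2 * a + 1 - w) * t); last by ring.
  rewrite normrM.
  move: tI => /=; rewrite in_itv/= -ltr_norml => t1.
  apply: (@le_trans _ _ (2 * a + 1 + 1)).
    rewrite -[leRHS]mulr1 ler_pM// ?(ltW t1)//.
    rewrite ger0_norm; lra.
  lra.
Qed.

Lemma horner_weight_integrable (R : realType) (a : R) (q : {poly R}) : 0 < a ->
  (@lebesgue_measure R).-integrable `]-1, 1[
    (EFin \o (fun t => q.[t] * (1 - t ^+ 2) `^ (a - 1))).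
Proof.
move=> a0; have [M qM] := bounded_horner q.
have iM : (@lebesgue_measure R).-integrable `]-1, 1[
    (fun t : R => M%:E * ((1 - t ^+ 2) `^ (a - 1))%R%:E)%E.
  by apply: integrableZl => //; exact: weight_integrable.
apply: (le_integrable _ _ _ iM) => //.
- by apply/measurable_EFinP; apply: measurable_horner_weight.
- move=> t tI /=; rewrite lee_fin !normrM ler_wpM2r//.
  by apply: le_trans (qM _ tI) _; rewrite ler_norm.
Qed.

(** The moment functional of the Gegenbauer weight, parametrized by
    a = alpha + 1/2 so that integrability is the condition a > 0. *)
Definition weight_moment (R : realType) (a : R) (q : {poly R}) : R :=
  \int[@lebesgue_measure R]_(t in `]-1, 1[) (q.[t] * (1 - t ^+ 2) `^ (a - 1)).

Lemma weight_momentD (R : realType) (a : R) (p q : {poly R}) : 0 < a ->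
  weight_moment a (p + q) = weight_moment a p + weight_moment a q.
Proof.
move=> a0; rewrite -RintegralD//; try exact: horner_weight_integrable.
by apply: eq_Rintegral => t _; rewrite hornerD mulrDl.
Qed.

Lemma weight_momentZ (R : realType) (a c : R) (q : {poly R}) : 0 < a ->
  weight_moment a (c *: q) = c * weight_moment a q.
Proof.
move=> a0; rewrite -RintegralZl//; last exact: horner_weight_integrable.
by apply: eq_Rintegral => t _; rewrite hornerZ mulrA.
Qed.

Lemma weight_momentN (R : realType) (a : R) (q : {poly R}) : 0 < a ->
  weight_moment a (- q) = - weight_moment a q.
Proof. by move=> a0; rewrite -scaleN1r weight_momentZ// mulN1r. Qed.

Lemma cvg_horner_weight0 (R : realType) (a l : R) (q : {poly R}) (u : nat -> R) :
  0 < a -> l ^+ 2 = 1 -> (forall k, u k \in `]-1, 1[) -> u @ \oo --> l ->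
  q.[u k] * (1 - u k ^+ 2) `^ a @[k --> \oo] --> 0.
Proof.
move=> a0 l1 uI ul; rewrite -(mulr0 q.[l]).
apply: cvgM; first by apply: cvg_comp ul _; exact: continuous_horner.
apply: ((cvg_at_rightP (@powR R ^~ a) 0 0).1 (powR_cvg0 a0) (fun k => 1 - u k ^+ 2)).
split=> [k|]; first exact: onem_sqr_gt0.
rewrite -(subrr (1 : R)) -{3}l1; apply: cvgB; first exact: cvg_cst.
by rewrite expr2; apply: cvgM.
Qed.

Lemma countable_roots (R : realType) (q : {poly R}) : q != 0 ->
  countable [set t | root q t].
Proof.
move=> q0; apply: finite_set_countable; apply: contrapT => /infinite_set_fset.
move=> /(_ (size q)) [B Bq sB].
suff : (size (finmap.enum_fset B) < size q)%N by rewrite ltnNge sB.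
apply: max_poly_roots => //; last exact: finmap.fset_uniq.
by apply/allP => x xB; apply: Bq.
Qed.

(** The integrand is the derivative of q (1 - t^2)^a, which vanishes at -1
    and at 1. *)
Lemma weight_moment_Pearson (R : realType) (a : R) (q : {poly R}) : 0 < a ->
  weight_moment a (q^`() * (1 - 'X^2) - (2 * a) *: ('X * q)) = 0.
Proof.
have hI k : 0 < (k.+3%:R^-1 : R) < 1.
  by rewrite invr_gt0 ltr0Sn invf_lt1 ?ltr1n.
have h0 : k.+3%:R^-1 @[k --> \oo] --> (0 : R).
  have := @cvg_harmonic R; rewrite -(cvg_shiftn 2) => h.
  by under eq_fun do rewrite -addn2.
move=> a0; apply: (integral_vanishing_primitive (exhausts_oo R)
  (F := fun t => q.[t] * (1 - t ^+ 2) `^ a)) => //.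
- move=> t tI; exact: is_derive_horner_weight.
- move=> t tI; exact: continuous_horner_weight.
- exact: horner_weight_integrable.
- apply: (@cvg_horner_weight0 _ _ (-1)) => //.
  + by rewrite sqrrN expr1n.
  + by move=> k; rewrite in_itv/=; move: (_^-1) (hI k) => h; lra.
  + by rewrite -[X in _ --> X]add0r; apply: cvgB => //; exact: cvg_cst.
- apply: (@cvg_horner_weight0 _ _ 1) => //.
  + by rewrite expr1n.
  + by move=> k; rewrite in_itv/=; move: (_^-1) (hI k) => h; lra.
  + by rewrite -[X in _ --> X]subr0; apply: cvgB => //; exact: cvg_cst.
Qed.

Lemma weight_moment_gt0 (R : realType) (a : R) (q : {poly R}) : 0 < a ->
  q != 0 -> (forall t, t \in `]-1, 1[ -> 0 <= q.[t]) -> 0 < weight_moment a q.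
Proof.
move=> a0 q0 qge0; apply: (@Rintegral_gt0 _ _ [set t | root q t]) => //.
- rewrite lebesgue_measure_itv/= lte_fin ifT; last lra.
  by rewrite -EFinB eqe; apply/eqP; lra.
- exact: countable_roots.
- exact: horner_weight_integrable.
- by move=> t tI; rewrite mulr_ge0 ?powR_ge0 ?qge0.
- move=> t tI /negP/= qt; rewrite mulf_neq0// gt_eqF// powR_gt0//.
  exact: onem_sqr_gt0.
Qed.

(** * Consequences of orthogonality *)

(** One step of division by a family with one polynomial in each degree. *)
Lemma size_sub_lead (F : fieldType) (m : nat) (g p : {poly F}) :
  size g = m.+1 -> (size p <= m.+1)%N ->
  (size (p - (p`_m / g`_m) *: g)%R <= m)%N.
Proof.
move=> sg sp; apply/leq_sizeP => j; rewrite leq_eqVlt => /predU1P[<-|mj].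
  rewrite coefB coefZ divfK ?subrr//.
  by have := lead_coef_eq0 g; rewrite /lead_coef sg /= => ->; rewrite -size_poly_eq0 sg.
rewrite coefB coefZ [p`_j]nth_default ?(leq_trans sp)//.
by rewrite [g`_j]nth_default ?sg// mulr0 subrr.
Qed.

(** On 'X^m the Euler operator 'X * d/dX is multiplication by [m], so
    subtracting [m%:R] cancels the top coefficient. *)
Lemma size_euler (F : fieldType) (m : nat) (p : {poly F}) :
  (size p <= m.+1)%N -> (size ('X * p^`() - m%:R *: p)%R <= m)%N.
Proof.
move=> sp; apply/leq_sizeP => -[|j] mj; rewrite coefB coefZ coefXM/=.
  by move: mj; rewrite leqn0 => /eqP ->; rewrite mul0r subrr.
rewrite coef_deriv; move: mj; rewrite leq_eqVlt => /predU1P[->|mj].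
  by rewrite mulr_natl subrr.
by rewrite nth_default ?mulr0 ?mul0rn ?subrr// (leq_trans sp).
Qed.

Lemma size_leqD (F : fieldType) (m : nat) (p q : {poly F}) :
  (size p <= m)%N -> (size q <= m)%N -> (size (p + q)%R <= m)%N.
Proof. by move=> pm qm; rewrite (leq_trans (size_polyD _ _))// geq_max pm. Qed.

Lemma size_leqZ (F : fieldType) (m : nat) (c : F) (p : {poly F}) :
  (size p <= m)%N -> (size (c *: p)%R <= m)%N.
Proof. exact/leq_trans/size_scale_leq. Qed.

Lemma size_leqX (F : fieldType) (m : nat) (p : {poly F}) :
  (size p <= m)%N -> (size ('X * p)%R <= m.+1)%N.
Proof.
by move=> pm; rewrite (leq_trans (size_polyMleq _ _))// size_polyX add2n.
Qed.

Lemma size_leq_deriv (F : fieldType) (m : nat) (p : {poly F}) :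
  (size p <= m.+1)%N -> (size p^`() <= m)%N.
Proof.
move=> pm; apply/leq_sizeP => j mj.
by rewrite coef_deriv nth_default ?mul0rn// (leq_trans pm).
Qed.

(** The polynomials [G k] with k < m span those of size at most [m]. *)
Lemma gegenbauer_orthogonal_lower (R : realType) (a : R)
    (G : nat -> {poly R}) :
  0 < a ->
  (forall k, size (G k) = k.+1) ->
  (forall k l, k != l -> weight_moment a (G k * G l) = 0) ->
  forall n (q : {poly R}), (size q <= n)%N -> weight_moment a (G n * q) = 0.
Proof.
move=> a0 sG oG n q qn.
have [m mn qm] : exists2 m, (m <= n)%N & (size q <= m)%N by exists n.
elim: m q {qn} mn qm => [|m IH] q mn qm.
  move: qm; rewrite leqn0 size_poly_eq0 => /eqP ->.
  by rewrite mulr0 -(scale0r 0) weight_momentZ// mul0r.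
rewrite -[q](subrK ((q`_m / (G m)`_m) *: G m)) mulrDr weight_momentD//.
rewrite IH ?(ltnW mn)//; last exact: size_sub_lead.
by rewrite add0r -scalerAr weight_momentZ// oG ?mulr0// gtn_eqF.
Qed.

(** Subtracting multiples of [G n.+1] and [G n] from [U] leaves a remainder of
    degree less than [n] that is orthogonal to itself. *)
Lemma orthogonal_two_terms (R : realType) (a : R) (G : nat -> {poly R})
    (n : nat) (U : {poly R}) : 0 < a ->
  (forall k, size (G k) = k.+1) ->
  (forall k l, k != l -> weight_moment a (G k * G l) = 0) ->
  (size U <= n.+2)%N ->
  (forall q : {poly R}, (size q <= n)%N -> weight_moment a (U * q) = 0) ->
  exists A B, U = B *: G n.+1 + A *: G n.
Proof.
move=> a0 sG oG sU oU.
pose B := U`_n.+1 / (G n.+1)`_n.+1.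
pose V1 := U - B *: G n.+1.
pose A := V1`_n / (G n)`_n.
pose V := V1 - A *: G n.
have sV : (size V <= n)%N.
  by apply: size_sub_lead => //; apply: size_sub_lead.
have V0 : V = 0.
  apply/eqP/negPn/negP => V0.
  have : 0 < weight_moment a (V * V).
    apply: weight_moment_gt0 => //; first by rewrite mulf_neq0.
    by move=> t _; rewrite hornerM -expr2 sqr_ge0.
  rewrite {1}/V /V1 !mulrBl !(weight_momentD, weight_momentN)// -!scalerAl.
  rewrite !weight_momentZ// oU//.
  rewrite !(gegenbauer_orthogonal_lower a0 sG oG)// ?(leq_trans sV)//.
  by rewrite !mulr0 !subrr ltxx.
exists A, B.
by move/eqP: V0; rewrite /V /V1 -addrA -opprD subr_eq0 => /eqP.
Qed.

(** Otherwise G n = (1 + 'X) * h with h of lower degree, and orthogonality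
    to h contradicts that (1 + t) h(t)^2 has positive integral. *)
Lemma gegenbauer_N1_neq0 (R : realType) (a : R) (G : nat -> {poly R})
    (n : nat) :
  0 < a ->
  (forall k, size (G k) = k.+1) ->
  (forall k l, k != l -> weight_moment a (G k * G l) = 0) ->
  (G n).[-1] != 0.
Proof.
move=> a0 sG oG; apply/negP => /factor_theorem[h Gh].
have Gn0 : G n != 0 by rewrite -size_poly_eq0 sG.
have h0 : h != 0 by apply: contraNneq Gn0; rewrite Gh => ->; rewrite mul0r.
have sh : (size h <= n)%N.
  by have := sG n; rewrite Gh size_Mmonic ?monicXsubC// size_XsubC addn2 => -[->].
have := gegenbauer_orthogonal_lower a0 sG oG sh; apply/eqP; rewrite gt_eqF//.
apply: weight_moment_gt0 => //; first by rewrite mulf_neq0.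
move=> t; rewrite in_itv/= => /andP[t1 _]; rewrite Gh !hornerE mulrAC.
by rewrite mulr_ge0 -?expr2 ?sqr_ge0// opprK; lra.
Qed.

(** Multiplying the left side by a test polynomial q and integrating by parts
    moves the derivative from P to q.  The factor N on the right is the one for
    which the terms of top degree then cancel against those of G n. *)
Lemma ggr_structure_relation (R : realType) (a : R) (G : nat -> {poly R}) (n : nat) :
  0 < a -> (0 < n)%N ->
  (forall k, size (G k) = k.+1) -> (forall k, (G k).[1] = 1) ->
  (forall k l, k != l -> weight_moment a (G k * G l) = 0) ->
  let P := G n + G n.+1 in P.[-1] = 0 ->
  (1 - 'X^2) * P^`() + n.+1%:R *: ('X * P) + (n%:R + 2 * a - 1) *: P
  = (2 * n%:R + 2 * a) *: ((1 + 'X) * G n).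
Proof.
move=> a0 n0 sG G1 oG P PN1.
have lowO := gegenbauer_orthogonal_lower a0 sG oG.
apply/eqP; rewrite -subr_eq0; apply/eqP; set U := _ - _.
have sP : (size P <= n.+2)%N.
  by rewrite (leq_trans (size_polyD _ _))// geq_max !sG leqnn leqnSn.
have sU : (size U <= n.+2)%N.
  (* The top coefficient cancels in the Euler part. *)
  have -> : U = P^`() - 'X * ('X * P^`() - n.+1%:R *: P)
      + (n%:R + 2 * a - 1) *: P - (2 * n%:R + 2 * a) *: ((1 + 'X) * G n).
    by rewrite /U -!mul_polyC; ring.
  have sP' : (size P^`() <= n.+1)%N := size_leq_deriv sP.
  apply: size_leqD; first apply: size_leqD; rewrite ?size_polyN.
  - apply: size_leqD; first exact: leqW.
    by rewrite size_polyN; apply/size_leqX/size_euler.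
  - exact: size_leqZ.
  - apply: size_leqZ; rewrite mulrDl mul1r size_leqD ?sG//.
    by apply: size_leqX; rewrite sG.
have oU (q : {poly R}) : (size q <= n)%N -> weight_moment a (U * q) = 0.
  move=> sq.
  (* What multiplies G n, once the Pearson equation for P * q is subtracted;
     its terms of degree n cancel. *)
  pose T := 'X * ('X * q^`() - n.-1%:R *: q) - q^`() - (n%:R + 1) *: q.
  have -> : U * q = ((P * q)^`() * (1 - 'X^2) - (2 * a) *: ('X * (P * q)))
     + G n.+1 * (T + (2 * n%:R + 2 * a) *: ((1 + 'X) * q)) + G n * T.
    rewrite /U /T /P -!mul_polyC derivM derivD.
    rewrite -[in RHS](prednK n0) -[in LHS](prednK n0)/= -!natr1 !polyCD.
    ring.
  rewrite weight_momentD// weight_momentD// weight_moment_Pearson// add0r.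
  have sT : (size T <= n)%N.
    apply: size_leqD; first apply: size_leqD; rewrite ?size_polyN.
    - rewrite -[leqRHS](prednK n0); apply/size_leqX/size_euler.
      by rewrite (prednK n0).
    - by apply: size_leq_deriv; apply: leqW.
    - exact: size_leqZ.
  rewrite !lowO ?addr0//; apply: size_leqD; first exact: leqW.
  apply: size_leqZ; rewrite mulrDl mul1r; apply: size_leqD; first exact: leqW.
  exact: size_leqX.
have [A [B UE]] := orthogonal_two_terms a0 sG oG sU oU.
have U1 : U.[1] = 0.
  rewrite /U /P !(hornerD,hornerN,hornerM,hornerZ,hornerX,hornerXn,hornerC) !G1 -natr1.
  ring.
have UN1 : U.[-1] = 0.
  rewrite /U !(hornerD,hornerN,hornerM,hornerZ,hornerX,hornerXn,hornerC) -hornerD PN1.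
  ring.
have := gegenbauer_N1_neq0 n a0 sG oG.
move: U1 UN1 PN1; rewrite UE /P !(hornerD,hornerZ) !G1 !mulr1 => AB UN1 PN1 GN1.
have BA : B = - A by apply/eqP; rewrite -addr_eq0 AB.
have GN : (G n.+1).[-1] = - (G n).[-1] by apply/eqP; rewrite -addr_eq0 addrC PN1.
move: UN1; rewrite BA GN mulrNN -mulr2n => /eqP.
rewrite mulrn_eq0/= mulf_eq0 (negPf GN1) orbF => /eqP A0.
by rewrite A0 oppr0 !scale0r addr0.
Qed.

(** * The Radau nodes and their barycentric weights *)

Lemma ggr_deriv_node (R : realType) (a : R) (G : nat -> {poly R}) (n : nat) :
  0 < a -> (0 < n)%N ->
  (forall k, size (G k) = k.+1) -> (forall k, (G k).[1] = 1) ->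
  (forall k l, k != l -> weight_moment a (G k * G l) = 0) ->
  let P := G n + G n.+1 in P.[-1] = 0 ->
  forall t, t != -1 -> P.[t] = 0 ->
    (1 - t) * P^`().[t] = (2 * n%:R + 2 * a) * (G n).[t].
Proof.
move=> a0 n0 sG G1 oG P PN1 t tN1 Pt.
have /(congr1 (horner^~ t)) := ggr_structure_relation a0 n0 sG G1 oG PN1.
rewrite -/P !(hornerD,hornerN,hornerM,hornerZ,hornerX,hornerXn,hornerC) -hornerD -/P Pt.
rewrite !mulr0 !addr0 => E.
apply: (@mulfI _ (1 + t)); first by rewrite addrC -(opprK 1) subr_eq0.
by rewrite mulrA [RHS]mulrCA -E; congr (_ * _); ring.
Qed.

(** At the endpoint -1 the structure relation reads 0 = 0, hence one takes its
    derivative there. *)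
Lemma ggr_deriv_node0 (R : realType) (a : R) (G : nat -> {poly R}) (n : nat) :
  0 < a -> (0 < n)%N ->
  (forall k, size (G k) = k.+1) -> (forall k, (G k).[1] = 1) ->
  (forall k l, k != l -> weight_moment a (G k * G l) = 0) ->
  let P := G n + G n.+1 in P.[-1] = 0 ->
    2 * a * P^`().[-1] = (2 * n%:R + 2 * a) * (G n).[-1].
Proof.
move=> a0 n0 sG G1 oG P PN1.
have /(congr1 (fun q => q^`().[-1])) := ggr_structure_relation a0 n0 sG G1 oG PN1.
rewrite -/P !(derivD, derivN, derivM, derivZ, derivX, derivXn, derivC).
rewrite !(hornerD,hornerN,hornerM,hornerZ,hornerX,hornerXn,hornerC,
  hornerMn) -!hornerD -!derivD -/P PN1.
rewrite /= -natr1 => E.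
(* The second factor is the product rule for (1 + 'X) * G n at -1. *)
transitivity ((2 * n%:R + 2 * a) *
  ((0 + 1) * (G n).[-1] + (1 + -1) * (G n)^`().[-1])); last by ring.
by rewrite -E; ring.
Qed.

(** Of the factors [tau j - tau i], exactly the [i] ones with j < i are
    negative. *)
Lemma bary_weight_sign (R : realType) (n : nat) (tau : 'I_n.+1 -> R) (i : 'I_n.+1) :
  (forall i j : 'I_n.+1, (i < j)%N -> tau i < tau j) ->
  bary_weight tau i = (-1) ^+ i * `|bary_weight tau i|.
Proof.
move=> inc; rewrite /bary_weight normfV normr_prod.
have tE (j : 'I_n.+1) : tau j - tau i = (-1) ^+ (j < i)%N * `|tau j - tau i|.
  case: (ltngtP j i) => [/inc|/inc|/val_inj->]; rewrite ?subrr ?normr0 ?mulr0//.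
    by move=> ji; rewrite ltr0_norm ?subr_lt0// mulN1r opprK.
  by move=> ji; rewrite gtr0_norm ?subr_gt0// expr0 mul1r.
rewrite [in LHS](eq_bigr _ (fun j _ => tE j)) big_split/= prodrXr.
rewrite (_ : (\sum_(j < n.+1 | j != i) (j < i))%N = i).
  by rewrite invfM -exprVn invrN1.
rewrite -[RHS]card_ord -sum1_card.
rewrite (big_ord_widen n.+1 (fun=> 1%N)); last exact/ltnW/ltn_ord.
rewrite big_mkcond [RHS]big_mkcond/=; apply: eq_bigr => j _.
by case: (eqVneq j i) => [->|_]; rewrite ?ltnn//; case: ltnP.
Qed.

Lemma bary_weight_deriv (R : realType) (n : nat) (tau : 'I_n.+1 -> R)
    (P : {poly R}) (i : 'I_n.+1) :
  injective tau -> size P = n.+2 -> (forall j, root P (tau j)) ->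
  P^`().[tau i] = lead_coef P * \prod_(j < n.+1 | j != i) (tau i - tau j).
Proof.
move=> tinj sP rP.
have PE : P = lead_coef P *: \prod_(j < n.+1) ('X - (tau j)%:P).
  rewrite -(big_map tau xpredT (fun x => 'X - x%:P)).
  apply: all_roots_prod_XsubC.
  - by rewrite size_map sP /index_enum -enumT size_enum_ord.
  - by apply/allP => _ /mapP[j _ ->].
  - by rewrite uniq_rootsE map_inj_uniq// /index_enum -enumT enum_uniq.
rewrite {1}PE derivZ hornerZ (bigD1 i)//= derivM hornerD !hornerM.
rewrite derivB derivX derivC subr0.
rewrite !hornerE subrr mul0r addr0 horner_prod; congr (_ * _).
by apply: eq_bigr => j _; rewrite !hornerE.
Qed.

(** The common shape of the two closed forms, with [y = 2 * a] at the node -1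
    and [y = 1 - tau i] at the other ones. *)
Lemma ggr_sqrt_weight (R : realType) (K N y g d : R) :
  0 <= K -> 0 < N -> g != 0 -> d != 0 -> y * d = N * g ->
  Num.sqrt (K * (y ^+ 2 * g ^- 2)) = Num.sqrt K * (N / `|d|).
Proof.
move=> K0 N0 g0 d0 e; rewrite sqrtrM// -expr_div_n sqrtr_sqr; congr (_ * _).
have -> : y / g = N / d by apply/eqP; rewrite eqr_div// e.
by rewrite normrM normfV gtr0_norm.
Qed.

Theorem theorem4p1 (R : realType) (alpha : R) (halpha : - 2^-1 < alpha)
    (n : nat) (hn : (0 < n)%N)
    (G : nat -> {poly R}) (hG : gegenbauer_family alpha G)
    (tau : 'I_n.+1 -> R) (htau : ggr_points G tau) :
  exists c : R,
    [/\ c != 0,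
        bary_weight tau ord0
        = c * - Num.sqrt ((2 * alpha + 1) * ggr_christoffel alpha G tau ord0)
      & forall i : 'I_n.+1, i != ord0 ->
        bary_weight tau i
        = c * ((-1) ^+ i.-1
               * Num.sqrt ((1 - tau i) * ggr_christoffel alpha G tau i))].
Proof.
have [sG G1 oG'] := hG; have [tau0 tauinc tauP] := htau.
pose a := alpha + 2^-1.
have a0 : 0 < a by rewrite /a; lra.
have aE : 2 * a = 2 * alpha + 1 by rewrite /a; lra.
have oG k l : k != l -> weight_moment a (G k * G l) = 0.
  move=> kl; rewrite -(oG' k l kl); apply: eq_Rintegral => t _.
  by rewrite hornerM /a (_ : alpha + 2^-1 - 1 = alpha - 2^-1)//; lra.
pose P := G n + G n.+1.
have rP j : P.[tau j] = 0 by apply/rootP/tauP; exists j.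
have PN1 : P.[-1] = 0 by rewrite -tau0.
have sP : size P = n.+2 by rewrite /P addrC size_polyDl ?sG.
have tau_inj : injective tau.
  move=> i j ij; apply/val_inj; case: (ltngtP i j) => // /tauinc; by rewrite ij ltxx.
have lP0 : lead_coef P != 0 by rewrite lead_coef_eq0 -size_poly_eq0 sP.
have dE i := bary_weight_deriv i tau_inj sP (fun j => introT rootP (rP j)).
have bE i : `|P^`().[tau i]| = `|lead_coef P| / `|bary_weight tau i|.
  rewrite dE normrM /bary_weight normfV invrK !normr_prod.
  by congr (_ * _); apply: eq_bigr => j _; rewrite distrC.
have b0 i : bary_weight tau i != 0.
  rewrite invr_eq0; apply/prodf_neq0 => j ji.
  by rewrite subr_eq0 (inj_eq tau_inj).
have d0 i : P^`().[tau i] != 0.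
  by rewrite -normr_gt0 bE divr_gt0 ?normr_gt0.
pose N : R := 2 * n%:R + 2 * a.
have n1 : 1 <= n%:R :> R by rewrite ler1n.
have N0 : 0 < N by rewrite /N; lra.
pose K : R := 2 `^ (2 * alpha - 1) * (Gamma (alpha + 2^-1) ^+ 2 * n`!%:R
     / ((n%:R + alpha + 2^-1) * Gamma (n%:R + 2 * alpha + 1))).
have K0 : 0 < K.
  rewrite mulr_gt0 ?powR_gt0// divr_gt0// mulr_gt0 ?exprn_gt0
    ?Gamma_gt0 ?ltr0n ?fact_gt0//; lra.
have sqrt_node (y : R) i : y != 0 -> y * P^`().[tau i] = N * (G n).[tau i] ->
    Num.sqrt (K * (y ^+ 2 * (G n).[tau i] ^- 2))
    = Num.sqrt K * N / `|lead_coef P| * `|bary_weight tau i|.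
  move=> y0 e; rewrite (@ggr_sqrt_weight _ K N y _ P^`().[tau i]) ?(ltW K0)//.
    by rewrite bE invf_div !mulrA mulrAC.
  apply: contra_eq_neq e => ->; rewrite mulr0; exact: mulf_neq0.
have sK0 : Num.sqrt K != 0 by rewrite gt_eqF// sqrtr_gt0.
pose c := - (`|lead_coef P| / (Num.sqrt K * N)).
have lP : `|lead_coef P| != 0 by rewrite normr_eq0.
have cK (x : R) : c * (Num.sqrt K * N / `|lead_coef P| * x) = - x.
  by rewrite /c; field; rewrite lP sK0 gt_eqF.
exists c; split.
- by rewrite oppr_eq0 mulf_neq0// invr_neq0// mulf_neq0// gt_eqF.
(* Here 1 - tau 0 = 2 completes the two factors to the square of 2 * a. *)
- rewrite /ggr_christoffel eqxx /ggr_theta -/K.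
  rewrite (_ : (2 * alpha + 1) * _ =
    K * ((2 * a) ^+ 2 * (G n).[tau ord0] ^- 2)); last first.
    by rewrite tau0 -aE -/a; ring.
  rewrite sqrt_node ?mulrN ?cK ?opprK; last 2 first.
  + by rewrite gt_eqF// mulr_gt0.
  + by rewrite tau0; apply: ggr_deriv_node0.
  by rewrite [LHS](bary_weight_sign _ tauinc) expr0 mul1r.
- move=> i i0; rewrite /ggr_christoffel (negPf i0) /ggr_theta -/K.
  have ti : tau i != -1 by rewrite -tau0 (inj_eq tau_inj).
  rewrite (_ : (1 - _) * _ = K * ((1 - tau i) ^+ 2 * (G n).[tau i] ^- 2)); last by ring.
  rewrite sqrt_node; last 2 first.
  + rewrite subr_eq0; apply/eqP => t1; move: (rP i).
    by rewrite -t1 hornerD !G1 => /eqP; rewrite gt_eqF.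
  + exact: ggr_deriv_node.
  rewrite mulrCA cK mulrN -mulNr [LHS](bary_weight_sign _ tauinc).
  by congr (_ * _); rewrite -(@prednK i) ?lt0n// exprS mulN1r.
Qed.
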